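(* Let $m\ge 2$, $n\ge 1$, let $\mathcal{A}=(a_{i_1\cdots i_m})\in T_{m,n}$ be strictly semi-positive, let $q\in\mathbb{R}^n$, and let $x$ be a solution of TCP$(\mathcal{A},q)$. If $\mathcal{A}$ is symmetric, then $$\frac{\|(-q)_+\|_2}{n^{\frac{m-2}{2}}\left(\sum\limits_{i=1}^{n}\left(\sum\limits_{i_2,\dots,i_m=1}^{n}|a_{ii_2\cdots i_m}|\right)^2\right)^{\frac12}}\le\|x\|_2^{m-1}\le\frac{\|(-q)_+\|_2}{\mu(\mathcal{A})}.$$
   Context: $T_{m,n}$ is the set of real tensors $\mathcal{A}=(a_{i_1\cdots i_m})$ of order $m$ and dimension $n$, with indices in $I_n=\{1,\dots,n\}$. $\mathcal{A}$ is symmetric if its entries are invariant under any permutation of the indices. For $x\in\mathbb{R}^n$, $\mathcal{A}x^{m-1}\in\mathbb{R}^n$ has components $(\mathcal{A}x^{m-1})_i=\sum_{i_2,\dots,i_m=1}^n a_{ii_2\cdots i_m}x_{i_2}\cdots x_{i_m}$, and $\mathcal{A}x^m=x^\top(\mathcal{A}x^{m-1})$. Inequalities between vectors are componentwise. $\mathcal{A}$ is strictly semi-positive if for each $x\ge 0$, $x\ne 0$, there is $k\in I_n$ with $x_k>0$ and $(\mathcal{A}x^{m-1})_k>0$. A solution of the tensor complementarity problem TCP$(\mathcal{A},q)$ is a vector $x\in\mathbb{R}^n$ with $x\ge 0$, $q+\mathcal{A}x^{m-1}\ge 0$ and $x^\top(q+\mathcal{A}x^{m-1})=0$. $x_+=(\max\{x_1,0\},\dots,\max\{x_n,0\})^\top$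 and $\|\cdot\|_2$ is the Euclidean norm. A real number $\mu$ is a Pareto $Z$-eigenvalue of $\mathcal{A}$ if there is a nonzero $x\in\mathbb{R}^n$ with $\mathcal{A}x^m=\mu(x^\top x)^{\frac m2}$, $\mathcal{A}x^{m-1}-\mu(x^\top x)^{\frac m2-1}x\ge 0$ and $x\ge 0$. $\mu(\mathcal{A})$ denotes the smallest Pareto $Z$-eigenvalue of $\mathcal{A}$. *)

(* Defs.v *)
From HB Require Import structures.
From mathcomp Require Import all_boot all_order all_algebra perm.
From mathcomp Require Import all_classical all_reals all_analysis.
Set Implicit Arguments.
Unset Strict Implicit.
Unset Printing Implicit Defensive.
Import Order.TTheory GRing.Theory Num.Theory.
Local Open Scope ring_scope.

(* The entry a_{i_1 ... i_m} is [A [tuple i_1; ...; i_m]]; the indices are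
   numbered from 0. *)
Definition tensor (R : Type) (m n : nat) : Type :=
  {ffun m.-tuple 'I_n -> R}.

Definition symmetric_tensor (R : realType) (m n : nat) (A : tensor R m n) :
    Prop :=
  forall (s : 'S_m) (t : m.-tuple 'I_n),
    A [tuple tnth t (s j) | j < m] = A t.

(* The sum over (i_2, ..., i_m) for a fixed i_1 = i is written as a sum over
   the m-tuples of head i; this avoids casts between m and m.-1.+1. *)
Definition tensor_app (R : realType) (m n : nat) (A : tensor R m n)
    (x : 'cV[R]_n) : 'cV[R]_n :=
  \col_i \sum_(t : m.-tuple 'I_n | ohead t == Some i)
    A t * \prod_(j <- behead t) x j 0.

Definition dotv (R : realType) (n : nat) (x y : 'cV[R]_n) : R :=
  (x^T *m y) 0 0.

Definition tensor_form (R : realType) (m n : nat) (A : tensor R m n)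
    (x : 'cV[R]_n) : R :=
  dotv x (tensor_app A x).

(* The library norm on matrices is the sup norm. *)
Definition norm2 (R : realType) (n : nat) (x : 'cV[R]_n) : R :=
  Num.sqrt (dotv x x).

Definition nonnegv (R : realType) (n : nat) (x : 'cV[R]_n) : Prop :=
  forall i, 0 <= x i 0.

Definition posv (R : realType) (n : nat) (x : 'cV[R]_n) : 'cV[R]_n :=
  \col_i Num.max (x i 0) 0.

Definition strictly_semi_positive (R : realType) (m n : nat)
    (A : tensor R m n) : Prop :=
  forall x : 'cV[R]_n, nonnegv x -> x != 0 ->
    exists k : 'I_n, 0 < x k 0 /\ 0 < tensor_app A x k 0.

Definition TCP_solution (R : realType) (m n : nat) (A : tensor R m n)
    (q x : 'cV[R]_n) : Prop :=
  [/\ nonnegv x, nonnegv (q + tensor_app A x)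
    & dotv x (q + tensor_app A x) = 0].

Definition pareto_Z_eigenvalue (R : realType) (m n : nat) (A : tensor R m n)
    (mu : R) : Prop :=
  exists x : 'cV[R]_n,
    [/\ x != 0,
        tensor_form A x = mu * dotv x x `^ (m%:R / 2),
        nonnegv (tensor_app A x - (mu * dotv x x `^ (m%:R / 2 - 1)) *: x)
      & nonnegv x].

Definition is_smallest_pareto_Z_eigenvalue (R : realType) (m n : nat)
    (A : tensor R m n) (mu : R) : Prop :=
  pareto_Z_eigenvalue A mu /\
  forall nu : R, pareto_Z_eigenvalue A nu -> mu <= nu.

(* [xget] selects the (unique) smallest Pareto Z-eigenvalue; it is 0
   when there is none. *)
Definition pareto_Z_mu (R : realType) (m n : nat) (A : tensor R m n) : R :=
  xget 0 [set mu | is_smallest_pareto_Z_eigenvalue A mu]%classic.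

(* Main.v *)
(* On the nonnegative part of the unit sphere, x |-> A x^m attains its minimum
   mu at some y.  By homogeneity mu |x|^m <= A x^m for all x >= 0, so no Pareto
   Z-eigenvalue is below mu.  Since A is symmetric, the right derivative at 0 of
   t |-> A (y + t e_i)^m - mu |y + t e_i|^m, which is minimal at t = 0, equals
   m ((A y^(m-1))_i - mu y_i); hence A y^(m-1) >= mu y, with equality on the
   support of y.  So mu is the smallest Pareto Z-eigenvalue, and strict
   semi-positivity applied to y gives mu > 0.  For a solution x,
   mu |x|^m <= A x^m = - q . x <= |(-q)_+| |x| is the upper bound.  The lower one
   follows from (-q)_+ <= |A x^(m-1)| <= S |x|^(m-1) entrywise, where S_i is
   the i-th absolute row sum, and from n^((m-2)/2) >= 1. *)

Require Import Defs.
From HB Require Import structures.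
From mathcomp Require Import all_boot all_order all_algebra perm.
From mathcomp Require Import all_classical all_reals all_analysis.
From mathcomp Require Import ring lra.
Set Implicit Arguments.
Unset Strict Implicit.
Unset Printing Implicit Defensive.
Import Order.TTheory GRing.Theory Num.Theory.
Import numFieldNormedType.Exports.
Local Open Scope ring_scope.

(** * Euclidean inner product and norm on column vectors *)

Section Euclidean.
Variables (R : realType) (n : nat).
Implicit Types x y z : 'cV[R]_n.

Lemma dotvE x y : dotv x y = \sum_i x i 0 * y i 0.
Proof. by rewrite /dotv mxE; apply: eq_bigr => i _; rewrite mxE. Qed.

Lemma dotvC x y : dotv x y = dotv y x.
Proof. by rewrite !dotvE; apply: eq_bigr => i _; rewrite mulrC. Qed.

Lemma dotvDr x y z : dotv x (y + z) = dotv x y + dotv x z.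
Proof. by rewrite /dotv mulmxDr mxE. Qed.

Lemma dotvZr c x y : dotv x (c *: y) = c * dotv x y.
Proof. by rewrite /dotv -scalemxAr mxE. Qed.

Lemma dotvDl x y z : dotv (x + y) z = dotv x z + dotv y z.
Proof. by rewrite dotvC dotvDr !(dotvC z). Qed.

Lemma dotvZl c x y : dotv (c *: x) y = c * dotv x y.
Proof. by rewrite dotvC dotvZr dotvC. Qed.

Lemma dotvNr x y : dotv x (- y) = - dotv x y.
Proof. by rewrite -scaleN1r dotvZr mulN1r. Qed.

Lemma dotv0l x : dotv 0 x = 0.
Proof. by rewrite -(scale0r x) dotvZl mul0r. Qed.

Lemma dotv_deltal i x : dotv (delta_mx i 0) x = x i 0.
Proof.
rewrite dotvE (bigD1 i) //= big1 => [|j ji]; last first.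
  by rewrite mxE (negPf ji) mul0r.
by rewrite mxE !eqxx mul1r addr0.
Qed.

Lemma dotvv_ge0 x : 0 <= dotv x x.
Proof. by rewrite dotvE sumr_ge0 // => i _; rewrite -expr2 sqr_ge0. Qed.

Lemma dotvv_eq0 x : (dotv x x == 0) = (x == 0).
Proof.
apply/idP/eqP => [|->]; last by rewrite dotv0l.
rewrite dotvE psumr_eq0 => [|i _]; last by rewrite -expr2 sqr_ge0.
move=> /allP x0; apply/matrixP => i j; rewrite ord1 mxE.
by have := x0 i (mem_index_enum _); rewrite /= mulf_eq0 orbb => /eqP.
Qed.

Lemma norm2_ge0 x : 0 <= norm2 x.
Proof. exact: sqrtr_ge0. Qed.

Lemma sqr_norm2 x : norm2 x ^+ 2 = dotv x x.
Proof. by rewrite sqr_sqrtr ?dotvv_ge0. Qed.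

Lemma norm2_eq0 x : (norm2 x == 0) = (x == 0).
Proof. by rewrite -sqrf_eq0 sqr_norm2 dotvv_eq0. Qed.

Lemma norm2_gt0 x : x != 0 -> 0 < norm2 x.
Proof. by rewrite lt_def norm2_ge0 norm2_eq0 andbT. Qed.

Lemma norm2Z c x : 0 <= c -> norm2 (c *: x) = c * norm2 x.
Proof.
move=> c0; rewrite /norm2 dotvZl dotvZr mulrA -expr2 sqrtrM ?sqr_ge0 //.
by rewrite sqrtr_sqr ger0_norm.
Qed.

(** Bridges the real powers of the eigenvalue equation and the natural powers of the norm. *)
Lemma powR_dotvv_half x k : dotv x x `^ (k%:R / 2) = norm2 x ^+ k.
Proof.
by rewrite mulrC powRrM powR12_sqrt ?dotvv_ge0 // powR_mulrn ?norm2_ge0.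
Qed.

(** Cauchy-Schwarz: for nonzero vectors, expand the square of |y| x - |x| y, which is nonnegative,
    and cancel the positive factor |x| |y|. *)
Lemma ler_dotv_norm2 x y : dotv x y <= norm2 x * norm2 y.
Proof.
have [->|x0] := eqVneq x 0; first by rewrite dotv0l mulr_ge0 ?norm2_ge0.
have [->|y0] := eqVneq y 0.
  by rewrite dotvC dotv0l mulr_ge0 ?norm2_ge0.
have ab0 : 0 < norm2 x * norm2 y by rewrite mulr_gt0 ?norm2_gt0.
have := dotvv_ge0 (norm2 y *: x - norm2 x *: y).
rewrite dotvDl !dotvDr -!scaleNr !dotvZl !dotvZr (dotvC y x) -!sqr_norm2.
set a := norm2 x in ab0 *; set b := norm2 y in ab0 *; set d := dotv x y.
move=> h; rewrite -(ler_pM2l ab0).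
have : 0 <= 2 * ((a * b) * (a * b) - (a * b) * d) by apply: le_trans h _; lra.
by rewrite pmulr_rge0 // subr_ge0.
Qed.

Lemma ler_norm2 x y : (forall i, `|x i 0| <= y i 0) -> norm2 x <= norm2 y.
Proof.
move=> xy; rewrite ler_wsqrtr // !dotvE ler_sum // => i _.
rewrite -!expr2 -(real_normK (num_real (x i 0))).
by rewrite lerXn2r ?nnegrE ?(le_trans _ (xy i)).
Qed.

Lemma ler_coord_norm2 x i : `|x i 0| <= norm2 x.
Proof.
rewrite -sqrtr_sqr ler_wsqrtr // dotvE (bigD1 i) //= -expr2 lerDl.
by rewrite sumr_ge0 // => j _; rewrite -expr2 sqr_ge0.
Qed.

End Euclidean.

(** * The form as a polynomial in the coordinates: homogeneity and an entrywise bound *)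

Section TensorForm.
Variables (R : realType) (m n : nat) (A : tensor R m.+1 n).
Implicit Types x y v : 'cV[R]_n.

Lemma ohead_thead (T : Type) (t : m.+1.-tuple T) : ohead t = Some (thead t).
Proof. by rewrite {1}(tuple_eta t). Qed.

(** Grouping the tuples by their head merges the double sum into one. Keeping [v] apart from [y]
    serves to recognise directional derivatives later. *)
Lemma dotv_tensor_app v y :
  dotv v (tensor_app A y) =
  \sum_(t : m.+1.-tuple 'I_n)
     A t * (v (thead t) 0 * \prod_(j <- behead t) y j 0).
Proof.
rewrite dotvE (partition_big (fun t : m.+1.-tuple 'I_n => thead t) xpredT) //=.
apply: eq_bigr => i _; rewrite mxE big_distrr /=.
rewrite [RHS](eq_bigl (fun t : m.+1.-tuple 'I_n => ohead t == Some i)).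
  apply: eq_bigr => t; rewrite ohead_thead => /eqP[<-].
  by rewrite mulrCA.
by move=> t; rewrite ohead_thead.
Qed.

Lemma tensor_formE y :
  tensor_form A y = \sum_(t : m.+1.-tuple 'I_n) A t * \prod_k y (tnth t k) 0.
Proof.
rewrite /tensor_form dotv_tensor_app; apply: eq_bigr => t _; congr (_ * _).
by rewrite -(big_tuple _ _ t xpredT (fun j => y j 0)) [in RHS](tuple_eta t) big_cons.
Qed.

Lemma tensor_formZ c y : tensor_form A (c *: y) = c ^+ m.+1 * tensor_form A y.
Proof.
rewrite !tensor_formE big_distrr; apply: eq_bigr => t _ /=.
rewrite mulrCA; congr (_ * _); under eq_bigr do rewrite mxE.
by rewrite big_split /= prodr_const card_ord.
Qed.

Lemma norm_tensor_app_le y i :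
  `|tensor_app A y i 0| <=
  (\sum_(t : m.+1.-tuple 'I_n | ohead t == Some i) `|A t|) * norm2 y ^+ m.
Proof.
rewrite mxE big_distrl /=; apply: le_trans (ler_norm_sum _ _ _) _.
apply: ler_sum => t _; rewrite normrM ler_wpM2l // normr_prod.
(* [behead t] has length [m], so the power is a product over it and the factors compare one by
   one. *)
rewrite [leRHS](_ : _ = \prod_(j <- behead t) norm2 y); last first.
  by rewrite big_const_seq count_predT size_behead size_tuple -Monoid.iteropE.
by apply: ler_prod => j _; rewrite normr_ge0 ler_coord_norm2.
Qed.

End TensorForm.

(** * Derivatives of the norm and of the form along a line *)

Section FirstOrder.
Variable R : realType.

(** Induction on the list with the product rule for two factors; [uniq r] ensures that the filter
    [j != i] drops exactly one factor. *)
Lemma is_derive_prod (I : eqType) (r : seq I) (f : I -> R -> R) (df : I -> R)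
    (x : R) :
  uniq r -> (forall i, is_derive x 1 (f i) (df i)) ->
  is_derive x 1 (fun t => \prod_(i <- r) f i t)
    (\sum_(i <- r) df i * \prod_(j <- r | j != i) f j x).
Proof.
move=> + dfP; elim: r => [_|i r ih /= /andP[ir ur]].
  rewrite big_nil; under eq_fun do rewrite big_nil; exact: is_derive_cst.
rewrite (_ : (fun t => _) = f i * (fun t => \prod_(j <- r) f j t)); last first.
  by apply/funext => t; rewrite big_cons.
apply: is_derive_eq; first exact: is_deriveM (dfP i) (ih ur).
rewrite big_cons addrC; congr (_ + _).
  rewrite big_cons eqxx /GRing.scale /= mulrC; congr (_ * _).
  rewrite [RHS]big_seq_cond [LHS]big_seq; apply: eq_bigl => j.
  by have [->|] := eqVneq j i; rewrite ?(negPf ir) ?andbT.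
rewrite scaler_sumr [in RHS]big_seq [LHS]big_seq; apply: eq_bigr => j jr.
rewrite big_cons (_ : i != j); last by apply: contraNneq ir => ->.
by rewrite /= mulrCA.
Qed.

(** The derivative is also the limit of the difference quotients from the right, and these are
    nonnegative. *)
Lemma is_derive_ge0 (g : R -> R) (x d : R) : is_derive x 1 g d ->
  (forall t, x <= t -> g x <= g t) -> 0 <= d.
Proof.
move=> [dg <-] gx; rewrite ['D_1 g x]cvg_at_rightE; last exact: dg.
apply: limr_ge.
  (* Convergence over the punctured neighbourhood of 0 restricts to its right half. *)
  rewrite -(cvg_at_rightE (fun h : R => h^-1 *: ((g \o shift x) _ - g x))) //.
  apply: cvg_trans dg; apply: cvg_app.
  move=> S [e e0 Se]; exists e => // t te t0.
  by apply: Se => //; exact/lt0r_neq0.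
near=> h; have h0 : 0 < h by near: h; exists 1 => /=.
apply: mulr_ge0; first by rewrite invr_ge0 ltW.
by rewrite subr_ge0 gx //= [_%:A]mulr1 lerDr ltW.
Unshelve. all: by end_near. Qed.

Variable n : nat.

(** Chain rule for the square root of the quadratic polynomial [g]; [y != 0] makes [g 0] positive,
    where the root is differentiable. *)
Lemma is_derive_norm2_line (y v : 'cV[R]_n) : y != 0 ->
  is_derive (0 : R) 1 (fun t => norm2 (y + t *: v)) (dotv y v / norm2 y).
Proof.
move=> y0; pose g (t : R) := dotv y y + (dotv y v *+ 2) * t + dotv v v * t ^+ 2.
rewrite (_ : (fun t => _) = Num.sqrt \o g); last first.
  apply/funext => t; rewrite /norm2 /=; congr Num.sqrt.
  by rewrite dotvDl !dotvDr !dotvZl !dotvZr /g (dotvC v y); ring.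
have g0 : g 0 = dotv y y by rewrite /g; ring.
have dg : is_derive (0 : R) 1 g (dotv y v *+ 2).
  rewrite (_ : g = cst (dotv y y) + (dotv y v *+ 2) \*: id +
                     dotv v v \*: (id ^+ 2)).
    apply: is_derive_eq; rewrite /= /GRing.scale /=; ring.
  by apply/funext => t; rewrite /g exprfctE.
apply: is_derive_eq.
  apply: (is_derive1_comp (f := Num.sqrt) (g := g)); apply: is_derive1_sqrt.
  by rewrite g0 -sqr_norm2 exprn_gt0 // norm2_gt0.
rewrite g0 -/(norm2 y); have := norm2_gt0 y0 => ?; field; lra.
Qed.

Variables (m : nat) (A : tensor R m.+1 n).

Lemma prod_behead (F : 'I_n -> R) (t : m.+1.-tuple 'I_n) :
  \prod_(j <- behead t) F j = \prod_(k | k != ord0) F (tnth t k).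
Proof.
rewrite [RHS]big_mkcond big_ord_recl eqxx /= mul1r.
rewrite (big_tuple _ _ [tuple of behead t] xpredT F).
apply: eq_bigr => i _; rewrite tnth_behead /=.
by congr (F (tnth t _)); apply/val_inj; rewrite /= inordK // ltnS.
Qed.

(* Reindexing the tuples by the transposition of the positions 0 and k moves v
   from slot k to slot 0. *)
Lemma symmetric_tensor_slot (v y : 'cV[R]_n) (k : 'I_m.+1) :
  symmetric_tensor A ->
  \sum_(t : m.+1.-tuple 'I_n)
     A t * (v (tnth t k) 0 * \prod_(l | l != k) y (tnth t l) 0) =
  dotv v (tensor_app A y).
Proof.
move=> sA; rewrite dotv_tensor_app; pose s := tperm ord0 k.
pose h (t : m.+1.-tuple 'I_n) := [tuple tnth t (s j) | j < m.+1].
have hK : involutive h.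
  by move=> t; apply: eq_from_tnth => j; rewrite !tnth_mktuple /s tpermK.
rewrite (reindex_inj (inv_inj hK)); apply: eq_bigr => t _.
rewrite sA tnth_mktuple /s tpermR; congr (_ * (_ * _)).
rewrite (prod_behead (fun j => y j 0)) (reindex_inj (@perm_inj _ s)).
apply: eq_big => [l|l _]; last by rewrite tnth_mktuple /s tpermK.
by rewrite -{1}(tpermL ord0 k) (inj_eq perm_inj).
Qed.

(** The product rule gives one sum for each slot that [v] can occupy; by symmetry these [m.+1] sums
    are all equal. *)
Lemma is_derive_tensor_form_line (y v : 'cV[R]_n) : symmetric_tensor A ->
  is_derive (0 : R) 1 (fun t => tensor_form A (y + t *: v))
    (m.+1%:R * dotv v (tensor_app A y)).
Proof.
move=> sA.
pose f (s : m.+1.-tuple 'I_n) (k : 'I_m.+1) (t : R) :=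
  y (tnth s k) 0 + t * v (tnth s k) 0.
have df s k : is_derive (0 : R) 1 (f s k) (v (tnth s k) 0).
  rewrite (_ : f s k = cst (y (tnth s k) 0) + v (tnth s k) 0 \*: id).
    by apply: is_derive_eq; rewrite add0r /GRing.scale /= mulr1.
  by apply/funext => t; rewrite /f /= mulrC.
have dprod s := is_derive_prod (index_enum_uniq 'I_m.+1) (df s).
have dsum : is_derive (0 : R) 1
    (\sum_s (A s \*: (fun t => \prod_k f s k t)))
    (\sum_s A s * (\sum_k v (tnth s k) 0 * \prod_(l | l != k) f s l 0)).
  elim/big_ind2 : _ => [|F dF G dG FP GP|s _]; first exact: is_derive_cst.
    exact: is_deriveD.
  exact: is_deriveZ.
rewrite (_ : (fun t => _) = \sum_s (A s \*: (fun t => \prod_k f s k t))).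
  apply: (is_derive_eq dsum).
  under eq_bigr do rewrite big_distrr.
  rewrite exchange_big /= (eq_bigr (fun=> dotv v (tensor_app A y))).
    by rewrite sumr_const card_ord mulr_natl.
  move=> k _; rewrite -(symmetric_tensor_slot _ _ k sA); apply: eq_bigr => s _.
  by congr (_ * (_ * _)); apply: eq_bigr => l _; rewrite /f mul0r addr0.
apply/funext => t; rewrite tensor_formE fct_sumE; apply: eq_bigr => s _ /=.
by congr (_ * _); apply: eq_bigr => k _; rewrite !mxE.
Qed.

End FirstOrder.

(** * The smallest Pareto Z-eigenvalue as a minimum over the nonnegative unit sphere *)

Section ParetoMinimum.
Variables (R : realType) (m n : nat) (A : tensor R m.+1 n).
Implicit Types x y : 'cV[R]_n.

(** Compactness gives a minimiser on the sphere; both sides are homogeneous of degree [m.+1], which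
    carries the inequality to the whole orthant. *)
Lemma tensor_form_min_sphere : (0 < n)%N -> exists y,
  [/\ nonnegv y, norm2 y = 1 & forall x, nonnegv x ->
    tensor_form A y * norm2 x ^+ m.+1 <= tensor_form A x].
Proof.
move=> n0.
(* Row vectors are the format of [EVT_min_rV]; a basis vector shows below that [S] is nonempty. *)
pose S := [set u : 'rV[R]_n | (forall i, 0 <= u 0 i) /\ dotv u^T u^T = 1]%classic.
pose i0 := Ordinal n0; have Sne : S (delta_mx i0 0)^T.
  split => [i|]; first by rewrite !mxE ler0n.
  by rewrite trmxK dotv_deltal mxE !eqxx.
have ccoord (i : 'I_n) : continuous (fun u : 'rV[R]_n => u^T i 0).
  by under eq_fun do rewrite mxE; exact: coord_continuous.
have Sc : compact S.
  apply: bounded_closed_compact.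
    exists 1; split => // M M1 u [u0 u1] /=.
    rewrite [leLHS]mx_normrE; apply: bigmax_le; first by lra.
    move=> [i j] _ /=; rewrite ord1 (le_trans _ (ltW M1)) //.
    have := ler_coord_norm2 u^T j; rewrite mxE => /le_trans; apply.
    by rewrite /norm2 u1 sqrtr1.
  rewrite (_ : S =
      \bigcap_i (fun u : 'rV[R]_n => u^T i 0) @^-1` [set x | 0 <= x] `&`
      (fun u : 'rV[R]_n => dotv u^T u^T) @^-1` [set 1])%classic; last first.
    apply/seteqP; split => u [u0 u1]; split => // i.
      by move=> _; rewrite /= mxE.
    by have := u0 i I; rewrite /= mxE.
  apply: closedI.
    apply: closed_bigI => i _; apply: closed_comp; last exact: closed_ge.
    by move=> u _; exact: ccoord.
  apply: closed_comp; last exact: closed_eq.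
  move=> u _; under eq_fun do rewrite dotvE.
  apply: continuous_big => [|i _]; first exact: add_continuous.
  by move=> w; apply: continuousM; exact: ccoord.
have [|u /set_mem[u0 u1] umin] :=
    @EVT_min_rV R n (fun u => tensor_form A u^T) S (ex_intro _ _ Sne) Sc.
  apply: continuous_subspaceT; under eq_fun do rewrite tensor_formE.
  apply: continuous_big => [|s _]; first exact: add_continuous.
  move=> w; apply: continuousM; first exact: cst_continuous.
  move: w; apply: continuous_big => [|k _]; last exact: ccoord.
  exact: mul_continuous.
exists u^T; split => [i| |x x0]; first by rewrite mxE.
  by rewrite /norm2 u1 sqrtr1.
(* At 0 both sides vanish, the exponent being positive; any other [x] is normalised. *)
have [->|xN0] := eqVneq x 0.
  rewrite (_ : norm2 0 = 0) ?expr0n ?mulr0; last by apply/eqP; rewrite norm2_eq0.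
  by rewrite -[X in tensor_form A X](scale0r 0) tensor_formZ expr0n mul0r.
have nx := norm2_gt0 xN0.
have /umin : ((norm2 x)^-1 *: x)^T \in S.
  apply/mem_set; split => [i|].
    by rewrite !mxE mulr_ge0 // invr_ge0 ltW.
  by rewrite trmxK dotvZl dotvZr -sqr_norm2; field; lra.
by rewrite trmxK tensor_formZ exprVn ler_pdivlMl ?exprn_gt0 // mulrC.
Qed.

(** Apply the bound to an eigenvector and divide by the positive power of its norm. *)
Lemma pareto_Z_eigenvalue_ge (c nu : R) :
  (forall x, nonnegv x -> c * norm2 x ^+ m.+1 <= tensor_form A x) ->
  pareto_Z_eigenvalue A nu -> c <= nu.
Proof.
move=> cP [z [z0 zE _ zge0]]; have := cP z zge0.
by rewrite zE powR_dotvv_half ler_pM2r // exprn_gt0 // norm2_gt0.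
Qed.

Lemma tensor_form_min_stationary y i : symmetric_tensor A -> nonnegv y -> norm2 y = 1 ->
  (forall x, nonnegv x ->
     tensor_form A y * norm2 x ^+ m.+1 <= tensor_form A x) ->
  tensor_form A y * y i 0 <= tensor_app A y i 0.
Proof.
move=> sA y0 y1 ymin; set mu := tensor_form A y.
have yN0 : y != 0 by rewrite -norm2_eq0 y1 oner_eq0.
pose v : 'cV[R]_n := delta_mx i 0.
(* [g] vanishes at 0 because |y| = 1, and it is nonnegative for t >= 0 because [y + t *: v] stays in
   the orthant. *)
pose g : R -> R := (fun t => tensor_form A (y + t *: v)) +
  (- mu) \*: ((fun t => norm2 (y + t *: v)) ^+ m.+1).
have := is_derive_tensor_form_line y v sA => dF.
have := is_derive_norm2_line v yN0 => dN.
have dg : is_derive (0 : R) 1 g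
    (m.+1%:R * (tensor_app A y i 0 - mu * y i 0)).
  apply: is_derive_eq; rewrite scale0r addr0 y1 expr1n divr1.
  by rewrite (dotvC y) /v !dotv_deltal /GRing.scale /= -mulr_natl; ring.
have gE t : g t = tensor_form A (y + t *: v) - mu * norm2 (y + t *: v) ^+ m.+1.
  by rewrite /g exprfctE -mulNr.
have := is_derive_ge0 dg; rewrite pmulr_rge0 ?ltr0n // subr_ge0; apply => t t0.
rewrite !gE scale0r addr0 y1 expr1n mulr1 subrr subr_ge0; apply: ymin => j.
by rewrite !mxE addr_ge0 ?y0 // mulr_ge0 // ler0n.
Qed.

(** The key is that [pareto_Z_mu A] equals the minimum of the form on the nonnegative unit sphere;
    positivity is then read off at the minimiser. *)
Lemma pareto_Z_mu_gt0_le_form : (0 < n)%N -> symmetric_tensor A ->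
  strictly_semi_positive A ->
  0 < pareto_Z_mu A /\
  forall x, nonnegv x -> pareto_Z_mu A * norm2 x ^+ m.+1 <= tensor_form A x.
Proof.
move=> n0 sA ssA; have [y [y0 y1 ymin]] := tensor_form_min_sphere n0.
have ystat i := tensor_form_min_stationary i sA y0 y1 ymin.
have yN0 : y != 0 by rewrite -norm2_eq0 y1 oner_eq0.
have yy : dotv y y = 1 by rewrite -sqr_norm2 y1 expr1n.
set mu := tensor_form A y in ymin ystat.
have mu_eig : pareto_Z_eigenvalue A mu.
  exists y; split => //; first by rewrite yy powR1 mulr1.
  by move=> i; rewrite yy powR1 mulr1 mxE [X in _ + X]mxE [X in - X]mxE subr_ge0.
have : is_smallest_pareto_Z_eigenvalue A (pareto_Z_mu A).
  (* [mu] is a smallest eigenvalue, so [xget] does not fall back on its default 0. *)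
  apply: xgetI (mu : R) _; split => // nu; exact: pareto_Z_eigenvalue_ge.
move=> [eig min]; have -> : pareto_Z_mu A = mu.
  by apply/le_anti; rewrite min //= (pareto_Z_eigenvalue_ge ymin).
split => //; have [k [yk Ayk]] := ssA y y0 yN0.
(* complementarity: the nonnegative terms below sum to 0 *)
have : \sum_i y i 0 * (tensor_app A y i 0 - mu * y i 0) == 0.
  under eq_bigr do rewrite mulrBr mulrCA.
  by rewrite sumrB -mulr_sumr -!dotvE yy mulr1 subrr.
rewrite psumr_eq0 => [/allP/(_ k (mem_index_enum _))|j _]; last first.
  by rewrite mulr_ge0 // subr_ge0 ystat.
(* At [k] the factor [y k 0] is positive, so the other one vanishes: [mu * y k 0] equals the
   positive [tensor_app A y k 0]. *)
rewrite /= mulf_eq0 gt_eqF //= subr_eq0 => /eqP E.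
by rewrite -(pmulr_lgt0 _ yk) -E.
Qed.

End ParetoMinimum.

(** * The two bounds on the norm of a solution *)

Theorem theorem3p14 (R : realType) (m n : nat) (hm : (2 <= m)%N)
    (hn : (1 <= n)%N) (A : tensor R m n) (hA : strictly_semi_positive A)
    (q x : 'cV[R]_n) (hx : TCP_solution A q x) (hsym : symmetric_tensor A) :
  norm2 (posv (- q)) /
    (n%:R `^ ((m%:R - 2) / 2) *
     (\sum_(i < n)
        (\sum_(t : m.-tuple 'I_n | ohead t == Some i) `|A t|) ^+ 2)
       `^ (1 / 2))
    <= norm2 x ^+ (m - 1)
  /\
  norm2 x ^+ (m - 1) <= norm2 (posv (- q)) / pareto_Z_mu A.
Proof.
(* From here on the order is [m.+1], and the exponent of the norm becomes [m], which is at least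
   1. *)
case: m hm A hA hx hsym => [//|m] hm A hA [x0 w0 xw0] hsym.
have [mu0 muP] := pareto_Z_mu_gt0_le_form hn hsym hA; rewrite subn1 /=.
pose S : 'cV[R]_n :=
  \col_i \sum_(t : m.+1.-tuple 'I_n | ohead t == Some i) `|A t|.
have -> : (\sum_(i < n)
    (\sum_(t : m.+1.-tuple 'I_n | ohead t == Some i) `|A t|) ^+ 2) `^ (1 / 2)
    = norm2 S.
  rewrite mul1r powR12_sqrt ?sumr_ge0 // => [|i _]; last exact: sqr_ge0.
  by rewrite /norm2 dotvE; congr Num.sqrt; apply: eq_bigr => i _; rewrite !mxE.
split.
  (* If [S = 0] the denominator is 0, and the quotient is 0 by the convention on inverses. *)
  have [SE|/norm2_gt0 S0] := eqVneq S 0.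
    have /eqP -> : norm2 S == 0 by rewrite norm2_eq0 SE.
    by rewrite mulr0 invr0 mulr0 exprn_ge0 ?norm2_ge0.
  have n1 : 1 <= n%:R `^ ((m.+1%:R - 2) / 2) :> R.
    rewrite -[leLHS](powRr0 n%:R) ler_powR ?ler1n // divr_ge0 //.
    by rewrite subr_ge0 ler_nat.
  rewrite ler_pdivrMr ?mulr_gt0 ?(lt_le_trans _ n1) //.
  apply: (@le_trans _ _ (norm2 (norm2 x ^+ m *: S))).
    (* Feasibility gives -q_i <= (A x^(m-1))_i in the notation of the statement, and the row-sum
       bound is nonnegative, so it also dominates the maximum with 0. *)
    apply: ler_norm2 => i; rewrite !mxE ger0_norm ?le_max ?lexx ?orbT //.
    rewrite ge_max mulr_ge0 ?exprn_ge0 ?norm2_ge0 ?sumr_ge0 // andbT.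
    rewrite mulrC; apply: le_trans (norm_tensor_app_le A x i).
    apply: le_trans (ler_norm _); have := w0 i; rewrite mxE; lra.
  rewrite norm2Z ?exprn_ge0 ?norm2_ge0 // ler_wpM2l ?exprn_ge0 ?norm2_ge0 //.
  by rewrite ler_peMl ?norm2_ge0.
have [xE|/norm2_gt0 nx] := eqVneq x 0.
  have /eqP -> : norm2 x == 0 by rewrite norm2_eq0 xE.
  by rewrite expr0n gtn_eqF // divr_ge0 ?norm2_ge0 ?ltW.
(* Multiplying by [norm2 x] raises the power to [m.+1], the degree of the estimate [muP]. *)
rewrite ler_pdivlMr // -(ler_pM2r nx) mulrAC -exprSr mulrC.
apply: le_trans (muP x x0) _; rewrite mulrC; apply: le_trans (ler_dotv_norm2 _ _).
(* This is the complementarity condition. *)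
have -> : tensor_form A x = dotv x (- q).
  by rewrite dotvNr /tensor_form; move: xw0; rewrite dotvDr; lra.
(* Passing from [- q] to its positive part only increases the product, since [x] is nonnegative. *)
rewrite !dotvE ler_sum // => i _; rewrite ler_wpM2l ?x0 // !mxE.
by rewrite le_max lexx.
Qed.
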